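(* The independence polynomial $I(T;x)$ of any well-covered spider $T$ is log-concave.
   Context: All graphs are finite, undirected, without loops or multiple edges, and have at least one vertex. A tree is an acyclic connected graph; a spider is a tree having at most one vertex of degree $\geq 3$. A stable set in a graph $G$ is a set of pairwise non-adjacent vertices; the stability number $\alpha(G)$ is the maximum size of a stable set in $G$. A graph is well-covered if all its maximal (with respect to inclusion) stable sets have the same cardinality. Let $s_k$ be the number of stable sets of cardinality $k$ in $G$ (so $s_0=1$); the independence polynomial of $G$ is $I(G;x)=\sum_{k=0}^{\alpha(G)}s_kx^k$. A finite sequence of real numbers $(a_0,a_1,\dots,a_n)$ is log-concave if $a_i^2\geq a_{i-1}a_{i+1}$ for all $1\leq i\leq n-1$; a polynomial is log-concave if its sequence of coefficients is log-concave. For reference, the well-covered spiders are $K_1$, $K_2$, $P_4$ (the path on 4 vertices) and the graphs $S_n=K_{1,n}^{\ast}$, $n\geq 2$, where $G^{\ast}$ denotes the graph obtained from $G$ by adding, for each vertex $v$ of $G$, one new vertex joined only to $v$, and $K_{1,n}$ is the star with $n$ leaves. *)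

(* Defs.v *)
From mathcomp Require Import all_boot all_order all_algebra.

Set Implicit Arguments.
Unset Strict Implicit.
Unset Printing Implicit Defensive.

Import Order.TTheory GRing.Theory Num.Theory.
Local Open Scope ring_scope.

(* Finite, undirected, loopless, without multiple edges, at least one vertex. *)
Record sgraph := SGraph {
  vertex :> finType;
  adj : rel vertex;
  adj_sym : symmetric adj;
  adj_irrefl : irreflexive adj;
  vertex_gt0 : (0 < #|vertex|)%N
}.

Section Graphs.
Variable G : sgraph.

Definition degree (v : G) : nat := #|[set w : G | adj v w]|.

Definition connected_graph : Prop := forall x y : G, connect (@adj G) x y.

(* The bound on the length is needed: for an edge xy, the sequence [:: x; y]
   satisfies ucycle. *)
Definition acyclic : Prop :=
  forall c : seq G, (3 <= size c)%N -> ~ ucycle (@adj G) c.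

Definition is_tree : Prop := connected_graph /\ acyclic.

Definition is_spider : Prop :=
  is_tree /\ (#|[set v : G | (3 <= degree v)%N]| <= 1)%N.

Definition stable (S : {set G}) : bool :=
  [forall x in S, forall y in S, ~~ adj x y].

Definition stability_number : nat := \max_(S : {set G} | stable S) #|S|.

Definition well_covered : Prop :=
  forall S1 S2 : {set G}, maxset stable S1 -> maxset stable S2 -> #|S1| = #|S2|.

Definition num_stable (k : nat) : nat :=
  #|[set S : {set G} | stable S & #|S| == k]|.

Definition indep_poly (R : nzSemiRingType) : {poly R} :=
  \poly_(k < stability_number.+1) (num_stable k)%:R.

End Graphs.

(* The sequence is (a_0, ..., a_n) with n + 1 = size a; the condition is
   imposed for 1 <= i <= n - 1. *)
Definition log_concave (R : realDomainType) (a : seq R) : Prop :=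
  forall i : nat, (1 <= i)%N -> (i.+1 < size a)%N ->
    a`_(i.-1) * a`_(i.+1) <= a`_i ^+ 2.

(* polyseq p lists the coefficients of p up to its leading one. *)
Definition log_concave_poly (R : realDomainType) (p : {poly R}) : Prop :=
  log_concave (polyseq p).

(* Main.v *)
(* In a well-covered graph, stable sets A, B with N[B] contained in N[A] satisfy
   |B| <= |A|. In a tree this forces every vertex of degree at least 2 to have
   exactly one leaf neighbour. In a spider, the center (a vertex of maximal
   degree) then has one leaf and all its other neighbours have degree 2 and carry
   one leaf, so that T is K_1 or some K_{1,n}^* with n >= 0. Conditioning on the
   center, I(K_{1,n}^*; x) = (1 + x) (1 + 2x)^n + x (1 + x)^n. For n >= 1 this is
   1 + x times the polynomial with coefficients
   a_k = 2^k C(n,k) + C(n-1,k-1) = C(n,k) (2^k + k/n);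
   the sequence a_k is log-concave, since the gain from the binomial factor
   outweighs the defect of 2^k + k/n, and multiplication by 1 + x preserves
   log-concavity of nonnegative sequences without internal zeros. *)
Require Import Defs.
From mathcomp Require Import all_boot all_order all_algebra.
From mathcomp Require Import zify ring.

Set Implicit Arguments.
Unset Strict Implicit.
Unset Printing Implicit Defensive.

(** * Leaves in well-covered trees *)

Section WellCovered.
Variable G : sgraph.
Implicit Types (A B S : {set G}) (u v w x y z : G).

Lemma stableP S :
  reflect {in S &, forall x y, ~~ adj x y} (stable S).
Proof.
by apply: (iffP 'forall_in_'forall_in_idP) => h x y; [move=> ??|move=> ?];
  exact: h.
Qed.

(* A maximal stable M containing A misses N[A], hence N[B], outside A; so
   (M \ A) together with B is stable. *)
Lemma well_covered_exchange A B :
  well_covered G -> stable A -> stable B ->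
  {in B, forall b x, x = b \/ adj b x ->
    exists2 a, a \in A & x = a \/ adj a x} ->
  #|B| <= #|A|.
Proof.
move=> wc sA sB dom.
have [M mM sAM] := maxset_exists sA.
have /stableP sM := maxsetp mM.
have far b x : b \in B -> x = b \/ adj b x -> x \notin M :\: A.
  move=> bB /(dom _ bB)[a aA h]; rewrite inE; apply/negP => /andP[xA xM].
  case: h => [e|axy]; first by rewrite e aA in xA.
  by move: (sM _ _ (subsetP sAM _ aA) xM); rewrite axy.
have sCB : stable ((M :\: A) :|: B).
  apply/stableP => x y /setUP[xC|xB] /setUP[yC|yB].
  - by apply: sM; move: xC yC; rewrite !inE => /andP[_ ?] /andP[_ ?].
  - apply/negP; rewrite adj_sym => h.
    by have := far _ _ yB (or_intror h); rewrite xC.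
  - by apply/negP => h; have := far _ _ xB (or_intror h); rewrite yC.
  - by move/stableP: sB; apply.
have [M' mM' sM'] := maxset_exists sCB.
have := subset_leq_card sM'; rewrite -(wc _ _ mM mM').
rewrite cardsU (_ : _ :&: B = set0) ?cards0 ?subn0; last first.
  apply/setP => b; rewrite !inE; apply/negP => /andP[bC bB].
  by have := far _ _ bB (or_introl (erefl b)); rewrite inE bC.
by rewrite cardsD (setIidPr sAM); have := subset_leq_card sAM; lia.
Qed.

(* No immediate backtracking. In an acyclic graph such a walk is an induced path. *)
Fixpoint reduced (s : seq G) : bool :=
  if s is x :: s' then
    (if s' is _ :: z :: _ then x != z else true) && reduced s'
  else true.

(** If [x] recurs in the tail, loops and backtracking being excluded, the part of the walk before
    the first recurrence closes up to a cycle on at least three vertices. *)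
Lemma reduced_uniq x p :
  acyclic G -> path (@adj G) x p -> reduced (x :: p) -> uniq (x :: p).
Proof.
move=> ac; elim: p x => [//|y p IH] x /= /andP[axy pyp] /andP[xz red].
have uyp := IH _ pyp red.
rewrite -[_ && uniq p]/(uniq (y :: p)) uyp andbT.
apply/negP; rewrite inE => /orP[/eqP e|xp]; first by rewrite e adj_irrefl in axy.
case/splitPr: xp xz red pyp uyp => [[|z p1] p2] xz red pyp uyp.
  by rewrite /= eqxx in xz.
apply: (ac [:: x, y, z & p1]) => //; apply/andP; split.
  move: pyp; rewrite /= -!cats1 cat_path /= axy => /and3P[-> + /andP[e _]].
  by rewrite cat_path /= => ->; rewrite e.
move: uyp; rewrite -cat_cons -cat_rcons cat_uniq => /andP[+ _].
by rewrite rcons_uniq.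
Qed.

Lemma reduced_nonadj x y z p :
  acyclic G -> path (@adj G) x [:: y, z & p] -> reduced [:: x, y, z & p] ->
  ~~ adj x (last z p).
Proof.
move=> ac pp red; apply/negP => axl; apply: (ac [:: x, y, z & p]) => //.
rewrite /ucycle (reduced_uniq ac pp red) andbT.
by rewrite /cycle rcons_path pp /= adj_sym.
Qed.

Lemma reduced_neq x y p :
  acyclic G -> path (@adj G) x (y :: p) -> reduced [:: x, y & p] ->
  x != last y p.
Proof.
move=> ac pp /(reduced_uniq ac pp) /andP[xp _].
by apply: contraNneq xp => ->; exact: mem_last.
Qed.

(* Deleting closed neighbourhoods of vertices at distance 2 from v (one beyond
   each neighbour z <> u of v) makes v a leaf attached to u. *)
Definition detachable u v : Prop :=
  forall z, adj v z -> z != u -> exists2 x, adj z x & x != v.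

(* Two detachable neighbours v, w of u would become two leaves at u: trading u
   for v and w contradicts well-coveredness. *)
Lemma detachable_inj u v w :
  acyclic G -> well_covered G -> adj u v -> adj u w ->
  detachable u v -> detachable u w -> v = w.
Proof.
move=> ac wc auv auw dv dw; apply/eqP; apply/idPn => nvw.
pose D := [set v; w].
pose f t z := odflt z [pick x | adj z x & x != t].
(* One vertex beyond each neighbour [z != u] of [v] and of [w]; detachability keeps [f] from falling
   back on its default here. The sets to compare are [u |: X] and [D :|: X]. *)
pose X := \bigcup_(t in D) [set f t z | z in G & adj t z && (z != u)].
have adj_u t : t \in D -> adj u t by rewrite !inE => /orP[] /eqP->.
have XP x : x \in X -> exists t z,
    [/\ t \in D, [/\ adj u t, adj t u & u != t], adj t z /\ adj z t,
        (z != u) /\ (u != z) & [/\ adj z x, adj x z, x != t, t != x & x = f t z]].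
  case/bigcupP => t tD /imsetP[z]; rewrite inE => /andP[_ /andP[tz zu]] xE.
  have [y zy yt] : exists2 x, adj z x & x != t.
    by move: tD tz zu; rewrite !inE => /orP[] /eqP->; [exact: dv|exact: dw].
  have {xE}: x = f t z /\ adj z x && (x != t).
    split=> //; rewrite xE /f; case: pickP => [y'|/(_ y)] //=.
    by rewrite zy yt.
  case=> xE /andP[zx xt]; exists t, z.
  have ut := adj_u _ tD.
  have tu : adj t u by rewrite adj_sym.
  have nut : u != t by apply: contraTneq ut => ->; rewrite adj_irrefl.
  have zt : adj z t by rewrite adj_sym.
  have xz : adj x z by rewrite adj_sym.
  by split=> //; split=> //; rewrite eq_sym.
(* Two vertices of [X] are joined by a reduced walk [x z t z' y], or [x z t u t' z' y] when they lie
   beyond different elements of [D]; acyclicity then forbids an edge. *)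
have nXX : {in X &, forall x y, ~~ adj x y}.
  move=> x y /XP[t [z [tD [ut tu nut] [tz zt] [zu uz] [zx xz xt tx xE]]]].
  move=> /XP[t' [z' [t'D [ut' tu' nut'] [tz' zt'] [zu' uz'] [zx' xz' xt' tx' yE]]]].
  have [e|ntt] := eqVneq t t'.
    subst t'; have [e|nzz] := eqVneq z z'; first by subst z'; rewrite xE -yE adj_irrefl.
    by apply: (@reduced_nonadj x z t [:: z'; y]) => //=; rewrite ?xz ?zt ?tz' ?zx' ?xt ?nzz ?tx'.
  apply: (@reduced_nonadj x z t [:: u; t'; z'; y]) => //=.
    by rewrite xz zt tu ut' tz' zx'.
  by rewrite xt zu ntt uz' tx'.
have nDX t x : t \in D -> x \in X -> ~~ adj t x /\ t != x.
  move=> tD /XP[t' [z' [t'D [ut' tu' nut'] [tz' zt'] [zu' uz'] [zx' xz' xt' tx' yE]]]].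
  have ut := adj_u _ tD.
  have [e|ntt] := eqVneq t t'.
    subst t'; split; last by [].
    by apply: (@reduced_nonadj t z' x [::]) => //=; rewrite ?tz' ?zx' ?tx'.
  have p : path (@adj G) t [:: u; t'; z'; x] by rewrite /= adj_sym ut ut' tz' zx'.
  have r : reduced [:: t; u; t'; z'; x] by rewrite /= ntt uz' tx'.
  by split; [exact: reduced_nonadj p r|exact: reduced_neq p r].
have nuX x : x \in X -> ~~ adj u x.
  move=> /XP[t' [z' [t'D [ut' tu' nut'] [tz' zt'] [zu' uz'] [zx' xz' xt' tx' yE]]]].
  by apply: (@reduced_nonadj u t' z' [:: x]) => //=; rewrite ?ut' ?tz' ?zx' ?uz' ?tx'.
have nDD : {in D &, forall x y, ~~ adj x y}.
  have nvw' : ~~ adj v w.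
    apply: (@reduced_nonadj v u w [::]) => //=; rewrite ?nvw //.
    by rewrite adj_sym auv auw.
  by move=> x y; rewrite !inE => /orP[] /eqP-> /orP[] /eqP->;
    rewrite ?adj_irrefl // adj_sym.
have sA : stable (u |: X).
  apply/stableP => x y /setU1P[->|xX] /setU1P[->|yX]; rewrite ?adj_irrefl //.
  - exact: nuX.
  - by rewrite adj_sym; exact: nuX.
  - exact: nXX.
have sB : stable (D :|: X).
  apply/stableP => x y /setUP[xD|xX] /setUP[yD|yX].
  - exact: nDD.
  - by case: (nDX x y).
  - by rewrite adj_sym; case: (nDX y x).
  - exact: nXX.
have := well_covered_exchange wc sA sB.
rewrite cardsU (_ : _ :&: X = set0); last first.
  apply/setP => t; rewrite in_set0 in_setI; apply/negP => /andP[tD tX].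
  by case: (nDX _ _ tD tX); rewrite eqxx.
rewrite cards2 nvw cards0 cardsU1 => h.
suff : 2 + #|X| - 0 <= (u \notin X) + #|X| by case: (_ \notin _); lia.
apply: h => b /setUP[bD|bX] x; last first.
  by move=> h; exists b => //; rewrite !inE bX orbT.
case=> [->|bx]; first by exists u; rewrite ?setU11 //; right; exact: adj_u.
(* A neighbour of [v] or [w] is either [u] or is adjacent to the vertex of [X] chosen beyond it. *)
have [->|xu] := eqVneq x u; first by exists u; rewrite ?setU11 //; left.
have fX : f b x \in X.
  by apply/bigcupP; exists b => //; apply/imsetP; exists x => //; rewrite inE bx xu.
exists (f b x); first by rewrite setU1r.
right; rewrite /f; case: pickP => [y /andP[+ _]|/=]; first by rewrite adj_sym.
have [y xy yb] : exists2 y, adj x y & y != b.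
  by move: bD bx xu; rewrite !inE => /orP[] /eqP->; [exact: dv|exact: dw].
by move=> /(_ y); rewrite xy yb.
Qed.

Definition leaf_of v w : Prop := adj v w /\ forall z, adj w z -> z = v.

Lemma leaf_detachable v w : leaf_of v w -> detachable v w.
Proof. by move=> [_ h] z /h ->; rewrite eqxx. Qed.

Lemma leaf_of_inj v w w' : acyclic G -> well_covered G ->
  leaf_of v w -> leaf_of v w' -> w = w'.
Proof.
move=> ac wc lw lw'; apply: (detachable_inj ac wc (proj1 lw) (proj1 lw')).
- exact: leaf_detachable.
- exact: leaf_detachable.
Qed.

Lemma leaf_ofP v w : adj v w ->
  leaf_of v w \/ exists2 z, adj w z & z != v.
Proof.
move=> avw; case: (pickP [pred z | adj w z & z != v]) => [z /andP[]|h].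
  by right; exists z.
left; split=> // z wz; apply/eqP; apply/idPn => zv.
by have := h z; rewrite /= wz zv.
Qed.

(** Suppose no neighbour of [v] is a leaf. A neighbour [t] of [v] with a leaf [z] would have two
    detachable neighbours, [z] and [v]. So every neighbour of [v] is itself detachable with respect
    to [v], and [u], [u'] coincide. *)
Lemma exists_leaf v u u' : acyclic G -> well_covered G ->
  adj v u -> adj v u' -> u != u' -> exists w, leaf_of v w.
Proof.
move=> ac wc avu avu' nuu.
pose lf w := adj v w && [forall z, adj w z ==> (z == v)].
case: (pickP lf) => [w /andP[vw /forallP h]|nolf].
  by exists w; split=> // z wz; apply/eqP; move: (h z); rewrite wz.
have det t : adj v t -> exists2 x, adj t x & x != v.
  move=> vt; case: (leaf_ofP vt) => // -[_ h].
  have := nolf t; rewrite /lf vt /= => /negbT/forallPn[z].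
  by rewrite negb_imply => /andP[/h ->]; rewrite eqxx.
have det_v t : adj v t -> detachable v t.
  move=> vt z tz zv; case: (leaf_ofP tz) => // lz.
  case/eqP: zv; have tv : adj t v by rewrite adj_sym.
  by apply: (detachable_inj ac wc tz tv (leaf_detachable lz)) => y /det.
by case/eqP: nuu; exact: detachable_inj ac wc avu avu' (det_v _ avu) (det_v _ avu').
Qed.

End WellCovered.

(** * Well-covered spiders *)

(* K_{1,n}^*: center c with pendant vertex c', each other neighbour u of c having
   the pendant vertex g u; n is the number of such u. K_2 is the case n = 0 and
   P_4 the case n = 1. *)
Record pendant_star (G : sgraph) (c c' : G) (g : G -> G) : Prop := PendantStar {
  star_center : leaf_of c c';
  star_leaf : forall u, adj c u -> u != c' -> leaf_of u (g u) /\ g u != c;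
  star_spoke : forall u z, adj c u -> u != c' -> adj u z -> z = c \/ z = g u;
  star_cover : forall x, [\/ x = c, x = c', adj c x |
    exists u, [/\ adj c u, u != c' & x = g u]]
}.

Section SpiderStructure.
Variable G : sgraph.
Implicit Types u v w x y z : G.

Lemma degree_le1 v x y : degree v <= 1 -> adj v x -> adj v y -> x = y.
Proof. by move=> /card_le1_eqP h vx vy; apply: h; rewrite inE. Qed.

Lemma degree_le2 v x y z : degree v <= 2 -> x != y ->
  adj v x -> adj v y -> adj v z -> z = x \/ z = y.
Proof.
move=> d xy vx vy vz; have [->|zx] := eqVneq z x; [by left|right].
apply/eqP; apply: contraLR d => zy; rewrite -ltnNge.
have <- : #|[set x; y; z]| = 3.
  rewrite -setUA setUC -setUA cardsU1 !inE negb_or.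
  by rewrite cards2 (eq_sym y) zy zx eq_sym xy.
apply: subset_leq_card; apply/subsetP => t; rewrite !inE.
by case/orP => [/orP[]|] /eqP->.
Qed.

Lemma connected_closed (P : pred G) c :
  connected_graph G -> P c -> (forall x y, P x -> adj x y -> P y) ->
  forall x, P x.
Proof.
move=> con Pc step x; have /connectP[p + ->] := con c x.
elim: p c Pc => [//|y p IH] c Pc /= /andP[cy]; apply: IH; exact: step cy.
Qed.

Lemma well_covered_spider_pendant_star :
  is_spider G -> well_covered G -> #|G| != 1 ->
  exists c c' g, @pendant_star G c c' g.
Proof.
move=> [[con ac] deg3] wc G1.
have [x0 _] : exists x0 : G, x0 \in G by apply/card_gt0P; exact: vertex_gt0.
(* Maximality singles out the branch vertex if there is one, and in every case leaves degree at most
   2 elsewhere. *)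
pose c := [arg max_(i > x0) degree i].
have cmax v : degree v <= degree c by rewrite /c; case: arg_maxnP => // i _; exact.
have deg2 v : v != c -> degree v <= 2.
  move=> vc; rewrite leqNgt; apply/negP => d; case/eqP: vc.
  by move/card_le1_eqP: deg3; apply; rewrite inE // (leq_trans d).
have [d cd] : exists d, adj c d.
  apply/existsP; apply: contraR G1 => /existsPn nc.
  have all_c x : pred1 c x.
    apply: (connected_closed con (c := c)) => [|y z /eqP-> h] /=; first exact: eqxx.
    by have := nc z; rewrite h.
  by apply/eqP/(@eq_card1 _ c) => x; apply/esym/all_c.
have [c' lc'] : exists c', leaf_of c c'.
  case: (pickP [pred d' | adj c d' & d' != d]) => [d' /andP[cd' dd]|h].
    exact: exists_leaf ac wc cd' cd dd.
  (* Here [d] is the only neighbour of [c], so by maximality of the degree of [c] the vertex [d] has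
     degree at most 1. *)
  exists d; split=> // z dz; rewrite adj_sym in cd.
  apply: degree_le1 dz cd; apply: leq_trans (cmax d) _.
  have all_d t : adj c t -> t = d.
    by move=> ct; apply/eqP; have := h t; rewrite /= ct => /negbFE.
  by apply/card_le1_eqP => x y; rewrite !inE => /all_d-> /all_d->.
pose lf u w := adj u w && [forall z, adj w z ==> (z == u)].
have lfP u w : reflect (leaf_of u w) (lf u w).
  apply: (iffP andP) => -[uw h]; split=> //.
    by move=> z wz; apply/eqP; move/forallP: h => /(_ z); rewrite wz.
  by apply/forallP => z; apply/implyP => /h ->.
pose g u := odflt u [pick w | lf u w].
(* Uniqueness of the leaf at [c] gives [u] a second neighbour, hence a leaf of its own; that leaf is
   not [c], which is adjacent to [c']. *)
have gP u : adj c u -> u != c' -> leaf_of u (g u) /\ g u != c.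
  move=> cu uc'.
  have lg : leaf_of u (g u).
    rewrite /g; case: pickP => [w /lfP //|no].
    case: (leaf_ofP cu) => [lu|[y uy yc]].
      by case/eqP: uc'; exact: leaf_of_inj ac wc lu lc'.
    have uc : adj u c by rewrite adj_sym.
    by have [w /lfP] := exists_leaf ac wc uy uc yc; rewrite no.
  split=> //; apply/eqP => e; case: lg => _; rewrite e => /(_ c' (proj1 lc')).
  by move=> e'; rewrite e' eqxx in uc'.
have spoke u z : adj c u -> u != c' -> adj u z -> z = c \/ z = g u.
  move=> cu uc' uz; have [[ug _] gc] := gP _ cu uc'.
  have uc : u != c by apply: contraTneq cu => ->; rewrite adj_irrefl.
  by apply: (degree_le2 (deg2 _ uc)); rewrite // 1?eq_sym // adj_sym.
exists c, c', g; split=> // x.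
pose P := [pred x | [|| x == c, x == c', adj c x |
  [exists u, [&& adj c u, u != c' & x == g u]]]].
suff: P x.
  case/or4P => [/eqP|/eqP||/existsP[u /and3P[? ? /eqP?]]];
    [by constructor 1|by constructor 2|by constructor 3|].
  by constructor 4; exists u.
(* The listed vertices contain [c] and are closed under adjacency, so by connectedness they exhaust
   the graph. *)
apply: (connected_closed con (c := c)); first by rewrite /= eqxx.
move=> {}x y; have [->|yc'] := eqVneq y c'; first by rewrite /= eqxx orbT.
case/or4P => [/eqP->|/eqP->|cx|/existsP[u /and3P[cu uc' /eqP->]]] xy.
- by rewrite /= xy !orbT.
- by rewrite (proj2 lc' _ xy) /= eqxx.
- have [e|xc'] := eqVneq x c'.
    by rewrite e in xy; rewrite (proj2 lc' _ xy) /= eqxx.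
  case: (spoke _ _ cx xc' xy) => ->; rewrite /= ?eqxx //.
  by apply/or4P; constructor 4; apply/existsP; exists x; rewrite cx xc' /=.
- have [[_ h] _] := gP _ cu uc'.
  by rewrite (h _ xy) /= cu !orbT.
Qed.

End SpiderStructure.

(** * Log-concavity of the coefficients *)

Section LogConcaveNat.
Implicit Types a : nat -> nat.

Definition log_concave_nat a : Prop :=
  forall k, a k * a k.+2 <= a k.+1 ^ 2.

(** Multiply two consecutive log-concavity inequalities and cancel [a k.+1 * a k.+2]; the absence of
    internal zeros covers the case where this product vanishes. *)
Lemma log_concave_nat_gap a :
  log_concave_nat a -> (forall k, a k = 0 -> a k.+1 = 0) ->
  forall k, a k * a k.+3 <= a k.+1 * a k.+2.
Proof.
move=> lc a0 k; have h1 := lc k; have h2 := lc k.+1.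
have [e|p1] := posnP (a k.+2); first by rewrite (a0 _ e) muln0.
have p0 : 0 < a k.+1 by rewrite lt0n; apply: contraTneq p1 => /a0 ->.
rewrite -(@leq_pmul2l (a k.+1 * a k.+2)) ?muln_gt0 ?p0 ?p1 //.
have := leq_mul h1 h2; rewrite -!mulnn.
by congr (_ <= _); ring.
Qed.

(** Coefficients of the product with 1 + x. After expansion, two terms are bounded by log-concavity
    and the cross term by the gap inequality. *)
Lemma log_concave_nat_mul1X a :
  log_concave_nat a -> (forall k, a k = 0 -> a k.+1 = 0) ->
  log_concave_nat (fun k => a k + (if k is j.+1 then a j else 0)).
Proof.
move=> lc a0 [|k].
  by have := lc 0; have := lc 1; rewrite -!mulnn; nia.
have := lc k; have := lc k.+1; have := log_concave_nat_gap lc a0 k.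
by rewrite -!mulnn; nia.
Qed.

(* For n >= 1, I(K_{1,n}^*; x) = (1 + x) ((1 + 2x)^n + x (1 + x)^(n-1)); these are
   the coefficients of the second factor. *)
Definition spider_coef n k : nat :=
  2 ^ k * 'C(n, k) + (if k is j.+1 then 'C(n.-1, j) else 0).

(** The product form C(n,k) (2^k + k/n), at [n.+1] and with the denominator cleared. *)
Lemma mul_spider_coef n k :
  n.+1 * spider_coef n.+1 k = 'C(n.+1, k) * (n.+1 * 2 ^ k + k).
Proof.
rewrite /spider_coef; case: k => [|k /=]; first by rewrite !bin0; ring.
by rewrite mulnDr mul_bin_diag; ring.
Qed.

Lemma spider_coef_eq0 n k : spider_coef n.+1 k = 0 -> spider_coef n.+1 k.+1 = 0.
Proof.
move=> h; have := mul_spider_coef n k; rewrite h muln0.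
have := mul_spider_coef n k.+1.
have [lt|le] := ltnP n.+1 k.
  by rewrite (@bin_small n.+1 k.+1) 1?ltnW // mul0n => /eqP; rewrite muln_eq0 => /eqP.
move=> _ /esym/eqP; rewrite muln_eq0 -leqn0 leqNgt bin_gt0 le /=.
by rewrite addn_eq0 muln_eq0 expn_eq0.
Qed.

Lemma log_concave_spider_coef n : log_concave_nat (spider_coef n.+1).
Proof.
move=> k.
have [lt|le] := ltnP n k.+1.
  have -> : spider_coef n.+1 k.+2 = 0; last by rewrite muln0.
  by rewrite /spider_coef /= !bin_small //; lia.
rewrite -(@leq_pmul2l (n.+1 ^ 2)) ?expn_gt0 //.
have -> : n.+1 ^ 2 * (spider_coef n.+1 k * spider_coef n.+1 k.+2) =
  (n.+1 * spider_coef n.+1 k) * (n.+1 * spider_coef n.+1 k.+2) by ring.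
rewrite -expnMn !mul_spider_coef.
have e1 := mul_bin_left n.+1 k; have e2 := mul_bin_left n.+1 k.+1.
set C0 := 'C(n.+1, k) in e1 *; set C1 := 'C(n.+1, k.+1) in e1 e2 *.
set C2 := 'C(n.+1, k.+2) in e2 *.
pose d := n - k.
have e3 : n.+1 - k = d.+1 by rewrite /d; lia.
have e4 : n.+1 - k.+1 = d by rewrite /d; lia.
have en : n = k + d by rewrite /d; lia.
rewrite e3 in e1; rewrite e4 in e2.
(* With this factor, [e1] and [e2] turn [C0 * C2] into a multiple of [C1 ^ 2], which then
   cancels. *)
rewrite -(@leq_pmul2l (k.+2 * d.+1)) //.
rewrite !expnS expn0.
have qk : k < 2 ^ k by exact: ltn_expl.
set q := 2 ^ k in qk *.
have -> : k.+2 * d.+1 * (C0 * (n.+1 * q + k) * (C2 * (n.+1 * (2 * (2 * q)) + k.+2)))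
  = (d.+1 * C0) * (k.+2 * C2) * ((n.+1 * q + k) * (n.+1 * (4 * q) + k.+2)) by ring.
rewrite -e1 e2.
have -> : k.+1 * C1 * (d * C1) * ((n.+1 * q + k) * (n.+1 * (4 * q) + k.+2)) =
  C1 ^ 2 * (k.+1 * d * ((n.+1 * q + k) * (n.+1 * (4 * q) + k.+2))) by ring.
have -> : k.+2 * d.+1 *
   (C1 * (n.+1 * (2 * q) + k.+1) * (C1 * (n.+1 * (2 * q) + k.+1) * 1)) =
  C1 ^ 2 * (k.+2 * d.+1 * (n.+1 * (2 * q) + k.+1) ^ 2) by ring.
apply: leq_mul => //.
set N := n.+1 in en *.
have eN : N = k + d + 1 by rewrite /N; lia.
(* (2 N q + k + 1)^2 exceeds (N q + k)(4 N q + k + 2) by N q (2 - k) + 1; the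
   possibly negative part is absorbed by the binomial gain
   (k + 2)(d + 1) - (k + 1) d = N + 1. *)
have id : k.+1 * d * ((N * q + k) * (N * (4 * q) + k.+2)) + k.+1 * d * (N * q * 2 + 1) + N.+1 * (N * (2 * q) + k.+1) ^ 2
  = k.+2 * d.+1 * (N * (2 * q) + k.+1) ^ 2 + k.+1 * d * (N * q * k).
  by rewrite -!mulnn eN; ring.
suff : k.+1 * d * (N * q * k) <= N.+1 * (N * (2 * q) + k.+1) ^ 2 by lia.
(* By [k < q] the left side is at most N^3 q^2 = N (N q)^2, which the right side dominates factor by
   factor. *)
have b1 : k.+1 * d <= N * N by apply: leq_mul; lia.
have b2 : N * q * k <= N * q * q by rewrite leq_mul // ltnW.
apply: leq_trans (leq_mul b1 b2) _.
have -> : N * N * (N * q * q) = N * (N * q) ^ 2 by ring.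
apply: leq_mul; first by lia.
by rewrite leq_exp2r //; lia.
Qed.

End LogConcaveNat.

Import Order.TTheory GRing.Theory Num.Theory.
Local Open Scope ring_scope.

(** * Independence polynomials *)

Section IndependencePolynomial.
Variables (R : comNzRingType) (G : sgraph).
Implicit Types (A B S W : {set G}) (u v w x y z : G).

(** The independence polynomial of the subgraph induced on [A]; keeping [G] fixed lets vertices be
    deleted without building new graphs. *)
Definition set_indep_poly A : {poly R} :=
  \sum_(S : {set G} | (S \subset A) && stable S) 'X^#|S|.

Lemma indep_polyE : indep_poly G R = set_indep_poly setT.
Proof.
apply/polyP => k; rewrite coef_poly /set_indep_poly coef_sum.
under eq_bigr do rewrite coefXn.
have e : num_stable G k =
    (\sum_(S : {set G} | (S \subset [set: G]) && stable S) (k == #|S|))%N.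
  rewrite /num_stable -sum1dep_card big_mkcondr /=; apply: eq_big => S //.
    by rewrite subsetT.
  by rewrite eq_sym => _; case: eqP.
rewrite -natr_sum -e; case: ltnP => // lt.
rewrite e big1 // => S /andP[_ sS]; case: eqP => // kS.
have := @leq_bigmax_cond _ (@stable G) (fun S => #|S|) _ sS.
by rewrite -kS leqNgt lt.
Qed.

Lemma stableU1 v S :
  stable (v |: S) = stable S && [forall x in S, ~~ adj v x].
Proof.
apply/stableP/andP => [h|[/stableP h /forall_inP hv]].
  split; first by apply/stableP => x y xS yS; apply: h; rewrite setU1r.
  by apply/forall_inP => x xS; apply: h; rewrite ?setU11 ?setU1r.
move=> x y /setU1P[->|xS] /setU1P[->|yS].
- by rewrite adj_irrefl.
- exact: hv.
- by rewrite adj_sym; exact: hv.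
- exact: h.
Qed.

Lemma set_indep_poly0 : set_indep_poly set0 = 1.
Proof.
rewrite /set_indep_poly (big_pred1 set0) ?cards0 ?expr0 // => S.
rewrite subset0 /=; case: eqP => //= ->.
by apply/stableP => x y; rewrite inE.
Qed.

(** Stable sets are split by whether they contain [v]; those that do correspond, on removing [v], to
    stable sets avoiding its closed neighbourhood. *)
Lemma set_indep_poly_rec v A : v \in A ->
  set_indep_poly A = set_indep_poly (A :\ v)
    + 'X * set_indep_poly [set x in A :\ v | ~~ adj v x].
Proof.
move=> vA; rewrite /set_indep_poly (bigID (fun S => v \in S)) /= addrC.
congr (_ + _).
  by apply: eq_bigl => S; rewrite subsetD1 andbAC.
rewrite (reindex_onto (fun S => v |: S) (fun S => S :\ v)) /=; last first.
  by move=> S /andP[_ vS]; rewrite setD1K.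
rewrite big_distrr /=.
have vE S : ((v |: S) :\ v == S) = (v \notin S).
  apply/eqP/idP => [<-|vS]; first by rewrite !inE eqxx.
  by rewrite setU1K.
apply: eq_big => [S|S /andP[_]]; last by rewrite vE cardsU1 => ->; rewrite exprS.
rewrite vE setU11 andbT stableU1 subUset sub1set vA /=.
have -> : (S \subset [set x in A :\ v | ~~ adj v x]) =
   [&& S \subset A, v \notin S & [forall x in S, ~~ adj v x]].
  apply/subsetP/and3P => [h|[/subsetP h1 h2 /forall_inP h3] x xS].
    split.
    - by apply/subsetP => x /h; rewrite !inE => /andP[/andP[]].
    - by apply/negP => /h; rewrite !inE eqxx.
    - by apply/forall_inP => x /h; rewrite !inE => /andP[].
  rewrite !inE h1 // h3 // !andbT; by apply: contraNneq h2 => <-.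
by rewrite -!andbA; do !bool_congr.
Qed.

Lemma set_indep_poly_isolated v A : v \in A -> {in A, forall x, ~~ adj v x} ->
  set_indep_poly A = (1 + 'X) * set_indep_poly (A :\ v).
Proof.
move=> vA h; rewrite (set_indep_poly_rec vA) mulrDl mul1r.
congr (_ + 'X * set_indep_poly _); apply/setP => x; rewrite !inE.
by case: (boolP (x \in A)) => [/h->|]; rewrite ?andbF ?andbT.
Qed.

(** The edge is a component K_2 of the induced subgraph and contributes 1 + 2x: once [u] is deleted,
    [w] is isolated. *)
Lemma set_indep_poly_edge u w A : u \in A -> w \in A -> adj u w ->
  {in A, forall x, adj u x -> x = w} -> {in A, forall x, adj w x -> x = u} ->
  set_indep_poly A = (1 + 'X *+ 2) * set_indep_poly (A :\ u :\ w).
Proof.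
move=> uA wA uw hu hw; rewrite (set_indep_poly_rec uA).
have wu : w != u by apply: contraTneq uw => ->; rewrite adj_irrefl.
rewrite (_ : [set x in A :\ u | ~~ adj u x] = A :\ u :\ w); last first.
  apply/setP => x; rewrite !inE; case: (boolP (x \in A)) => [xA|]; last by rewrite !andbF.
  have [->|] := eqVneq x w; first by rewrite uw !andbF.
  rewrite !andbT /= => xw; case: (boolP (adj u x)) => [/hu e|]; last by rewrite andbT.
  by rewrite e ?eqxx in xw.
rewrite (@set_indep_poly_isolated w) ?inE ?wu //; last first.
  move=> x; rewrite !inE => /andP[xu xA]; apply: contra xu => /hw ->//.
ring.
Qed.

End IndependencePolynomial.

(** * The independence polynomial of a pendant star *)

Section StarPolynomial.
Variables (R : comNzRingType) (G : sgraph) (c c' : G) (g : G -> G).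
Hypothesis star : pendant_star c c' g.
Implicit Types (W : {set G}).

Let U : {set G} := [set u | adj c u & u != c'].

Let leafU u : u \in U -> leaf_of u (g u).
Proof. by rewrite inE => /andP[cu uc]; case: (star_leaf star cu uc). Qed.

Let adjg u x : u \in U -> adj (g u) x = (x == u).
Proof.
move=> /leafU[ug h]; apply/idP/eqP => [/h //|->]; by rewrite adj_sym.
Qed.

Let spokeU u z : u \in U -> adj u z -> z = c \/ z = g u.
Proof. by rewrite inE => /andP[cu uc]; exact: (star_spoke star). Qed.

Let adjc' x : adj c' x = (x == c).
Proof.
have [cc h] := star_center star.
apply/idP/eqP => [/h //|->]; by rewrite adj_sym.
Qed.

Let c_notin : c \notin U.
Proof. by rewrite inE adj_irrefl. Qed.

Let gU u : u \in U -> g u \notin U.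
Proof.
move=> uU; rewrite inE negb_and; apply/orP; left; rewrite adj_sym (adjg _ uU).
by apply: contraTneq uU => <-; exact: c_notin.
Qed.

Let gc u : u \in U -> g u != c.
Proof. by rewrite inE => /andP[cu uc]; case: (star_leaf star cu uc). Qed.

Let gc' u : u \in U -> g u != c'.
Proof.
move=> uU; apply: contraTneq (uU) => e.
by have := adjg c uU; rewrite e adjc' eqxx => /esym/eqP <-; exact: c_notin.
Qed.

Let g_inj : {in U &, injective g}.
Proof.
move=> u w uU wU e; apply/eqP; rewrite -(adjg _ wU) -e adjg //.
Qed.

(** What remains when [c] is chosen: isolated vertices, removed one at a time. *)
Let indep_leaves n W : #|W| = n -> W \subset U ->
  set_indep_poly R (g @: W) = (1 + 'X) ^+ n.
Proof.
elim: n W => [|n IH] W nW WU.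
  by rewrite (cards0_eq nW) imset0 set_indep_poly0.
have [u uW] : exists u, u \in W by apply/card_gt0P; rewrite nW.
have gW : {in W &, injective g} by move=> x y /(subsetP WU) xU /(subsetP WU); exact: g_inj.
have uU := subsetP WU _ uW.
rewrite (@set_indep_poly_isolated _ _ (g u)) ?imset_f //; last first.
  move=> x /imsetP[w /(subsetP WU) wU ->]; rewrite (adjg _ uU).
  by apply: contraTneq uU => <-; exact: gU.
have -> : g @: W :\ g u = g @: (W :\ u).
  apply/setP => x; rewrite !inE; apply/andP/imsetP => [[xg /imsetP[w wW e]]|[w]].
    by exists w; rewrite // !inE wW andbT; apply: contraNneq xg => <-; rewrite e.
  rewrite !inE => /andP[wu wW] ->; split; last exact: imset_f.
  by apply: contraNneq wu => /gW ->.
rewrite exprS IH //; last by rewrite (subset_trans (subsetDl _ _)).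
by move: nW; rewrite (cardsD1 u) uW => -[].
Qed.

(** What remains without [c] and [c']: disjoint edges from [u] to [g u], removed one at a time. *)
Let indep_spokes n W : #|W| = n -> W \subset U ->
  set_indep_poly R (W :|: g @: W) = (1 + 'X *+ 2) ^+ n.
Proof.
elim: n W => [|n IH] W nW WU.
  by rewrite (cards0_eq nW) imset0 setU0 set_indep_poly0.
have [u uW] : exists u, u \in W by apply/card_gt0P; rewrite nW.
have gW : {in W &, injective g} by move=> x y /(subsetP WU) xU /(subsetP WU); exact: g_inj.
have uU := subsetP WU _ uW.
have cW : c \notin W :|: g @: W.
  rewrite inE negb_or (contra (subsetP WU c)) //; apply/imsetP => -[w /(subsetP WU) wU e].
  by have := gc wU; rewrite -e eqxx.
rewrite (@set_indep_poly_edge _ _ u (g u)) ?inE ?uW ?imset_f ?orbT //; first last.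
- by move=> x _; rewrite (adjg _ uU) => /eqP.
- move=> x xW /(spokeU uU)[e|//]; by rewrite -e xW in cW.
- by case: (leafU uU).
have -> : (W :|: g @: W) :\ u :\ g u = (W :\ u) :|: g @: (W :\ u).
  apply/setP => x; rewrite !inE; apply/and3P/orP => [[xg xu /orP[xW|/imsetP[w wW e]]]|].
  - by left; rewrite xu.
  - right; apply/imsetP; exists w; rewrite // !inE wW andbT.
    by apply: contraNneq xg => <-; rewrite e.
  case=> [/andP[xu xW]|/imsetP[w]].
    split=> //; last by rewrite xW.
    by apply: contraTneq xW => ->; rewrite (contra (subsetP WU _)) ?gU.
  rewrite !inE => /andP[wu wW] ->; split; last by rewrite imset_f ?orbT.
    by apply: contraNneq wu => /gW ->.
  by apply: contraTneq uU => <-; rewrite gU ?(subsetP WU).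
rewrite exprS IH //; last by rewrite (subset_trans (subsetDl _ _)).
by move: nW; rewrite (cardsD1 u) uW => -[].
Qed.

Lemma pendant_star_indep_poly : exists n, indep_poly G R =
  (1 + 'X) * (1 + 'X *+ 2) ^+ n + 'X * (1 + 'X) ^+ n.
Proof.
have cc' : c' != c by rewrite -adjc' adj_irrefl.
exists #|U|; rewrite indep_polyE (@set_indep_poly_rec _ _ c) ?inE //.
congr (_ + 'X * _).
  rewrite (@set_indep_poly_isolated _ _ c') ?inE ?cc' //; last first.
    by move=> x; rewrite !inE andbT adjc'.
  rewrite -(indep_spokes erefl (subxx U)); congr (_ * set_indep_poly _ _).
  apply/setP => x; rewrite !inE andbT.
  apply/andP/orP => [[xc' xc]|[/andP[cx ->]|/imsetP[u uU ->]]].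
  - case: (star_cover star x) => [e|e|cx|[u [cu uc' ->]]].
    + by rewrite e eqxx in xc.
    + by rewrite e eqxx in xc'.
    + by left; rewrite cx.
    + by right; rewrite imset_f // inE cu.
  - by split=> //; apply: contraTneq cx => ->; rewrite adj_irrefl.
  - by rewrite gc ?gc'.
rewrite -(indep_leaves erefl (subxx U)); congr set_indep_poly.
apply/setP => x; rewrite !inE andbT.
apply/andP/imsetP => [[xc ncx]|[u uU ->]].
  case: (star_cover star x) => [e|e|cx|[u [cu uc' ->]]].
  - by rewrite e eqxx in xc.
  - by case: (star_center star) => h _; rewrite e h in ncx.
  - by rewrite cx in ncx.
  - by exists u; rewrite // inE cu.
rewrite gc //; split=> //; rewrite adj_sym (adjg _ uU).
by apply: contraTneq uU => <-; exact: c_notin.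
Qed.

End StarPolynomial.

(** * Coefficients of the star polynomial and conclusion *)

Lemma coef_exp1X (R : comNzRingType) m n k :
  ((1 + 'X *+ m) ^+ n : {poly R})`_k = (m ^ k * 'C(n, k))%:R.
Proof.
elim: n k => [|n IH] k.
  by rewrite expr0 coef1 bin0n; case: k => [|k]; rewrite ?muln0.
rewrite exprS mulrDl mul1r mulrnAl coefD coefMn coefXM !IH.
case: k => [|k] /=; first by rewrite mul0rn addr0 !bin0.
by rewrite binS -mulrnA -natrD expnS; congr (_%:R); ring.
Qed.

(** The factorisation by 1 + x, read off coefficientwise with Pascal's rule. *)
Lemma coef_star_poly (R : comNzRingType) n k :
  ((1 + 'X) * (1 + 'X *+ 2) ^+ n.+1 + 'X * (1 + 'X) ^+ n.+1 : {poly R})`_k =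
  (spider_coef n.+1 k + (if k is j.+1 then spider_coef n.+1 j else 0))%:R.
Proof.
have coef1 j : ((1 + 'X) ^+ n.+1 : {poly R})`_j = 'C(n.+1, j)%:R.
  by rewrite -['X]mulr1n coef_exp1X exp1n mul1n.
rewrite mulrDl mul1r !coefD !coefXM !coef_exp1X coef1.
case: k => [|k] /=; first by rewrite /spider_coef !addr0 !addn0 !bin0.
rewrite -!natrD /spider_coef /=; congr (_%:R).
by case: k => [|k]; rewrite ?bin0 ?binS; lia.
Qed.

Lemma size_le2_log_concave (R : realDomainType) (p : {poly R}) :
  (size p <= 2)%N -> log_concave_poly p.
Proof. by move=> sz [|i] // _ lt; move: (leq_trans lt sz). Qed.

Lemma star_poly_log_concave (R : realDomainType) n :
  log_concave_poly
    ((1 + 'X) * (1 + 'X *+ 2) ^+ n + 'X * (1 + 'X) ^+ n : {poly R}).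
Proof.
case: n => [|n].
  (* For n = 0 the polynomial is 1 + 2x, with no interior coefficient. *)
  apply: size_le2_log_concave; rewrite !expr0 !mulr1.
  by apply/leq_sizeP => -[|[|j]] // _; rewrite !coefD coef1 coefX !addr0.
move=> [|i] // _ _; rewrite !coef_star_poly -natrM -natrX ler_nat.
exact: (log_concave_nat_mul1X (@log_concave_spider_coef n) (@spider_coef_eq0 n)).
Qed.

Theorem theorem5 (R : realDomainType) (T : sgraph) (hspider : is_spider T)
  (hwc : well_covered T) : log_concave_poly (indep_poly T R).
Proof.
have [T1|T1] := eqVneq #|T| 1%N.
  (* On one vertex the stability number is at most 1. *)
  apply: size_le2_log_concave; apply: leq_trans (size_poly _ _) _.
  rewrite ltnS; apply/bigmax_leqP => S _; rewrite -T1; exact: max_card.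
have [c [c' [g star]]] := well_covered_spider_pendant_star hspider hwc T1.
have [n ->] := pendant_star_indep_poly R star.
exact: star_poly_log_concave.
Qed.
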